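(* Let $t\ge 2$ be an integer. There exists a positive real $c_1=c_1(t)$ such that the following holds: if $G$ is a $3$-graph that does not contain $M^3_t$ as a subgraph, $G$ has no isolated vertex, and $G\neq K^3_{3t-1}$, then $$\lambda(G)\le \lambda(K^3_{3t-1})-c_1=\frac{1}{6}\left(\frac{[3t-1]_3}{(3t-1)^3}-6c_1\right).$$
   Context: An $r$-graph $G$ is a set $V(G)$ of vertices together with a set of $r$-element subsets of $V(G)$ (edges); $H$ is a subgraph of $G$ if $V(H)\subseteq V(G)$ and $E(H)\subseteq E(G)$. $K^r_p$ is the complete $r$-graph on $p$ vertices. $M^r_t$ denotes the $r$-graph consisting of $t$ pairwise disjoint edges. For an $r$-graph $G$ on $[n]$ and $\vec x\in[0,\infty)^n$, $\lambda(G,\vec x)=\sum_{e\in E(G)}\prod_{i\in e}x_i$, and the Lagrangian is $\lambda(G)=\max\{\lambda(G,\vec x):\vec x\in[0,\infty)^n,\ \sum_i x_i=1\}$. For positive integers $m,r$, $[m]_r=m(m-1)\cdots(m-r+1)$. *)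

(* Defs.v *)
From HB Require Import structures.
From mathcomp Require Import all_boot all_order all_algebra.
From mathcomp Require Import all_classical all_reals all_analysis.

Set Implicit Arguments.
Unset Strict Implicit.
Unset Printing Implicit Defensive.

Import Order.TTheory GRing.Theory Num.Theory.
Import numFieldNormedType.Exports.

Local Open Scope ring_scope.

Record r_graph (r : nat) := RGraph {
  vertex : finType;
  edges : {set {set vertex}};
  edges_card : forall e, e \in edges -> #|e| = r
}.

Definition isolated_vertex (r : nat) (G : r_graph r) (v : vertex G) : Prop :=
  forall e, e \in edges G -> v \notin e.

(* [G] has a subgraph isomorphic to [H]. *)
Definition contains_copy (r : nat) (G H : r_graph r) : Prop :=
  exists f : vertex H -> vertex G,
    injective f /\ (forall e, e \in edges H -> (f @: e)%SET \in edges G).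

Definition rgraph_iso (r : nat) (G H : r_graph r) : Prop :=
  exists f : vertex G -> vertex H,
    bijective f /\
    (forall e, (e \in edges G) = ((f @: e)%SET \in edges H)).

Definition complete_edges (r p : nat) : {set {set 'I_p}} :=
  [set e : {set 'I_p} | #|e| == r]%SET.

Lemma complete_edges_card (r p : nat) (e : {set 'I_p}) :
  e \in complete_edges r p -> #|e| = r.
Proof. by rewrite inE => /eqP. Qed.

Definition complete_rgraph (r p : nat) : r_graph r :=
  RGraph (@complete_edges_card r p).

Definition matching_edges (r t : nat) : {set {set 'I_t * 'I_r}} :=
  [set [set (i, j) | j in 'I_r] | i in 'I_t]%SET.

Lemma matching_edges_card (r t : nat) (e : {set 'I_t * 'I_r}) :
  e \in matching_edges r t -> #|e| = r.
Proof.
case/imsetP => i _ ->; rewrite card_imset; last by move=> j k [].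
by rewrite card_ord.
Qed.

Definition matching_rgraph (r t : nat) : r_graph r :=
  RGraph (@matching_edges_card r t).

Definition lagrange_poly (R : realType) (r : nat) (G : r_graph r)
    (x : vertex G -> R) : R :=
  \sum_(e in edges G) \prod_(i in e) x i.

Arguments lagrange_poly {R r} G x.

Local Open Scope classical_set_scope.

Definition simplex (R : realType) (V : finType) : set (V -> R) :=
  [set x | (forall i, 0 <= x i) /\ \sum_i x i = 1].

(* The supremum is a maximum whenever [G] has a vertex, see [lagrangian_max];
   it is [0] when [G] has none. *)
Definition lagrangian (R : realType) (r : nat) (G : r_graph r) : R :=
  sup [set lagrange_poly G x | x in @simplex R (vertex G)].

Lemma continuous_bigop (T U : topologicalType) (op : U -> U -> U) (idx : U)
    (I : finType) (P : pred I) (F : I -> T -> U) :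
  (forall f g : T -> U, continuous f -> continuous g ->
    continuous (fun x => op (f x) (g x))) ->
  (forall i, continuous (F i)) ->
  continuous (fun x => \big[op/idx]_(i | P i) F i x).
Proof.
move=> opc Fc; elim: (index_enum I) => [|i s IH].
  have -> : (fun x : T => \big[op/idx]_(i <- [::] | P i) F i x) = fun=> idx.
    by apply/funext => x; rewrite big_nil.
  exact: cst_continuous.
have -> : (fun x : T => \big[op/idx]_(i <- i :: s | P i) F i x) =
    if P i then fun x => op (F i x) (\big[op/idx]_(i <- s | P i) F i x)
    else fun x => \big[op/idx]_(i <- s | P i) F i x.
  by case: ifP => Pi; apply/funext => x; rewrite big_cons Pi.
by case: (P i) => //; apply: opc.
Qed.

Lemma continuous_bigsum (T : topologicalType) (R : realType)
    (I : finType) (P : pred I) (F : I -> T -> R) :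
  (forall i, continuous (F i)) -> continuous (fun x => \sum_(i | P i) F i x).
Proof.
by apply: continuous_bigop => f g fc gc x; apply: cvgD; [exact: fc|exact: gc].
Qed.

Lemma continuous_bigprod (T : topologicalType) (R : realType)
    (I : finType) (P : pred I) (F : I -> T -> R) :
  (forall i, continuous (F i)) -> continuous (fun x => \prod_(i | P i) F i x).
Proof.
by apply: continuous_bigop => f g fc gc x; apply: cvgM; [exact: fc|exact: gc].
Qed.

Lemma closed_level (T : topologicalType) (R : realType) (f : T -> R) (a : R) :
  continuous f -> closed (f @^-1` [set a]).
Proof.
move=> fc; apply: preimage_closed; last exact: closed_eq.
by move=> x _; exact: fc.
Qed.

Lemma compact_max_sup (T : topologicalType) (R : realType) (f : T -> R)
    (A : set T) :
  A !=set0 -> compact A -> continuous f ->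
  exists2 x, A x & f x = sup (f @` A) /\ forall y, A y -> f y <= f x.
Proof.
move=> A0 cA fc.
have [x /set_mem Ax xmax] := compact_EVT_max A0 cA (continuous_subspaceT fc).
have {}xmax y : A y -> f y <= f x by move=> Ay; apply: xmax; exact/mem_set.
exists x => //; split => //; apply/eqP; rewrite eq_le; apply/andP; split.
- apply: ub_le_sup; last by exists x.
  by exists (f x) => _ [y Ay <-]; exact: xmax.
- apply: ge_sup; first by exists (f x); exists x.
  by move=> _ [y Ay <-]; exact: xmax.
Qed.

Lemma lagrangian_max (R : realType) (r : nat) (G : r_graph r) (v : vertex G) :
  exists2 x : vertex G -> R, simplex x &
    lagrange_poly G x = lagrangian R G /\
    forall y, simplex y -> lagrange_poly G y <= lagrange_poly G x.
Proof.
set V := vertex G; set S := @simplex R V.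
pose T : topologicalType := prod_topology (fun _ : V => (R : topologicalType)).
have pc (i : V) : continuous (fun x : T => x i : R).
  exact: (@proj_continuous V (fun=> (R : topologicalType)) i).
have sumc : continuous (fun x : T => \sum_i x i : R).
  by apply: continuous_bigsum => i; exact: pc.
have polyc : continuous (fun x : T => lagrange_poly G (x : V -> R)).
  apply: continuous_bigsum => e.
  by apply: continuous_bigprod => i; exact: pc.
have S0 : S !=set0.
  exists (fun i => (i == v)%:R); split => [i|]; first exact: ler0n.
  by rewrite (bigD1 v) //= eqxx big1 ?addr0 // => i /negbTE ->.
have cS : @compact T S.
  have -> : S = [set x : T | forall i, `[0, 1]%classic (x i)] `&`
      ((fun x : T => \sum_i x i) @^-1` [set 1]).
    apply/seteqP; split => x /= [x0 x1].
    - split => // i; rewrite /= in_itv /= x0 /= -x1 (bigD1 i) //= lerDl.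
      by apply: sumr_ge0 => j _.
    - by split => // i; have := x0 i; rewrite /= in_itv /= => /andP[].
  apply: compact_closedI.
    apply: (@tychonoff V (fun=> (R : topologicalType)) (fun=> `[0, 1]%classic)).
    by move=> i; exact: segment_compact.
  exact: closed_level.
by have [x Sx xmax] := @compact_max_sup T R _ S S0 cS polyc; exists x.
Qed.

(* Main.v *)
(** Write [p = 3t - 1] and let [F] be a family of triples of [T] that contains
    neither [M_t] nor [K_p], with weights on [T] summing to [1]. If two vertices
    of [T] lie in no common triple of [F], one of them can give its weight to
    the other and be discarded. If [|T| <= p], a quantitative Maclaurin
    inequality gives the gap. Otherwise let [m] be a vertex of maximum weight.
    Shifting towards [m] does not decrease the polynomial and creates no [M_t];
    it creates no [K_p] either when all pairs of [T] are covered. When no shift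
    towards [m] changes [F], every triple of [T] through [m] is in [F]; hence
    the triples avoiding [m] contain no [M_{t-1}] and, by induction on [t], with
    [a] the weight of [m], the polynomial is at most
    [a (1 - a)^2 / 2 + lambda(K_{p-3}) (1 - a)^3], which is bounded away from
    [lambda(K_p)].

    An [M_t]-free graph containing [K_p] has all its edges inside it, so without
    isolated vertices it is [K_p]. *)
From mathcomp Require Import all_classical all_reals all_analysis.
From mathcomp Require Import all_boot all_order all_algebra all_fingroup.
From mathcomp Require Import ring lra zify.
Require Import Defs.

Set Implicit Arguments.
Unset Strict Implicit.
Unset Printing Implicit Defensive.

Import Order.TTheory GRing.Theory Num.Theory.

Local Open Scope set_scope.
Local Open Scope ring_scope.

(** * Matchings and cliques in set families *)

Section SetFamilies.
Variable V : finType.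
Implicit Types (F M : {set {set V}}) (e A B K T : {set V}).

Definition uniform r F := forall e, e \in F -> #|e| = r.

Definition ksubsets k T : {set {set V}} :=
  [set e : {set V} | e \subset T & #|e| == k].

Definition has_matching F t :=
  [exists M : {set {set V}}, [&& M \subset F, trivIset M & #|M| == t]].

Definition has_clique r F p :=
  [exists K : {set V}, (#|K| == p) && (ksubsets r K \subset F)].

Definition link v F := [set e :\ v | e in F & v \in e].

Definition covers_pairs T F :=
  [forall i in T, forall j in T,
    (i != j) ==> [exists e in F, (i \in e) && (j \in e)]].

Lemma has_matchingP F t :
  reflect (exists M, [/\ M \subset F, trivIset M & #|M| = t])
    (has_matching F t).
Proof.
by apply: (iffP existsP) => -[M]; [case/and3P=> ? ? /eqP ?|case=> ? ? /eqP ?];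
  exists M => //; apply/and3P.
Qed.

Lemma has_matchingS F F' t :
  F \subset F' -> has_matching F t -> has_matching F' t.
Proof.
move=> FF' /has_matchingP[M [MF triv_M cardM]].
by apply/has_matchingP; exists M; split=> //; apply: subset_trans FF'.
Qed.

Lemma has_cliqueS r F F' p :
  F \subset F' -> has_clique r F p -> has_clique r F' p.
Proof.
move=> FF' /existsP[K /andP[cardK KF]]; apply/existsP; exists K.
by rewrite cardK (subset_trans KF).
Qed.

Lemma has_matching0 F : has_matching F 0.
Proof.
apply/has_matchingP; exists set0; split; rewrite ?sub0set ?cards0 //.
by apply/trivIsetP => A B; rewrite inE.
Qed.

Lemma ksubsets_uniform r T F : F \subset ksubsets r T -> uniform r F.
Proof. by move=> /subsetP FT e /FT; rewrite inE => /andP[_ /eqP]. Qed.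

Lemma ksubsets_sub r T F e : F \subset ksubsets r T -> e \in F -> e \subset T.
Proof. by move=> /subsetP FT /FT; rewrite inE => /andP[]. Qed.

Lemma uniform_ksubsets r T F :
  uniform r F -> (forall e, e \in F -> e \subset T) -> F \subset ksubsets r T.
Proof.
by move=> unifF FT; apply/subsetP => e eF; rewrite inE FT // unifF /=.
Qed.

Lemma ksubsetsS k A B : A \subset B -> ksubsets k A \subset ksubsets k B.
Proof.
move=> AB; apply/subsetP => e; rewrite !inE => /andP[eA ->].
by rewrite (subset_trans eA AB).
Qed.

Lemma ksubset_exists k T : (k <= #|T|)%N -> exists e, e \in ksubsets k T.
Proof. by move=> kT; apply/card_gt0P; rewrite cards_draws bin_gt0. Qed.

Lemma ssetI_ksubsets k T A : ksubsets k T ::&: A = ksubsets k (T :&: A).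
Proof. by apply/setP => e; rewrite !inE subsetI andbAC. Qed.

Lemma ssetIC1_ksubsets k T F v :
  F \subset ksubsets k T -> F ::&: [set~ v] \subset ksubsets k (T :\ v).
Proof.
move=> FT; rewrite setDE -ssetI_ksubsets; apply/subsetP => e.
by rewrite !inE => /andP[/(subsetP FT) + ->]; rewrite inE => /andP[-> ->].
Qed.

Lemma in_ssetIC1 F v e : (e \in F ::&: [set~ v]) = (e \in F) && (v \notin e).
Proof. by rewrite inE subsets_disjoint setCK disjoint_sym disjoints1. Qed.

Lemma link_ksubsets_sub k T F v :
  F \subset ksubsets k.+1 T -> link v F \subset ksubsets k (T :\ v).
Proof.
move=> /subsetP FT; apply/subsetP => _ /imsetP[e + ->].
rewrite inE => /andP[/FT + ve]; rewrite !inE => /andP[eT].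
by rewrite (cardsD1 v) ve setSD.
Qed.

Lemma link_ksubsets k T v :
  v \in T -> link v (ksubsets k.+1 T) = ksubsets k (T :\ v).
Proof.
move=> vT; apply/eqP; rewrite eqEsubset link_ksubsets_sub //=.
apply/subsetP => e; rewrite inE subsetD1 => /andP[/andP[eT v'e] carde].
apply/imsetP; exists (v |: e); last by rewrite setU1K.
by rewrite !inE subUset sub1set vT eT cardsU1 v'e (eqP carde) !eqxx.
Qed.

Lemma has_matchingU1 r F e t : (0 < r)%N -> uniform r F -> e \in F ->
  has_matching (F ::&: ~: e) t -> has_matching F t.+1.
Proof.
move=> r_gt0 unifF eF /has_matchingP[M [MFe triv_M cardM]].
have MF f : f \in M -> f \in F /\ f \subset ~: e.
  by move=> /(subsetP MFe); rewrite inE => /andP[].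
have M_disj : {in M, forall f : {set V}, [disjoint e & f]}.
  by move=> f /MF[_]; rewrite disjoint_sym disjoints_subset.
have M0 : set0 \notin M.
  by apply/negP => /MF[/unifF]; rewrite cards0 => r0; rewrite -r0 in r_gt0.
have [triv_eM eM] := trivIsetU1 M_disj triv_M M0.
apply/has_matchingP; exists (e |: M); split; rewrite ?cardsU1 ?eM ?cardM //.
by rewrite subUset sub1set eF; apply/subsetP => f /MF[].
Qed.

Lemma ksubsets_has_matching r A t : (0 < r)%N -> (r * t <= #|A|)%N ->
  has_matching (ksubsets r A) t.
Proof.
move=> r_gt0; elim: t A => [|t IHt] A tA; first exact: has_matching0.
have [|e eA] := @ksubset_exists r A; first by apply: leq_trans tA; lia.
apply: (has_matchingU1 r_gt0 (ksubsets_uniform (subxx _)) eA).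
rewrite ssetI_ksubsets; apply: IHt; rewrite -setDE.
move: eA; rewrite inE => /andP[eA /eqP carde].
by rewrite cardsD (setIidPr eA) carde; lia.
Qed.

Lemma has_matching_clique_edge r F K e t : (0 < r)%N -> uniform r F ->
  #|K| = (r * t.+1).-1 -> ksubsets r (K :\: e) \subset F ->
  e \in F -> ~~ (e \subset K) -> has_matching F t.+1.
Proof.
move=> r_gt0 unifF cardK KF eF e'K; apply: (has_matchingU1 r_gt0 unifF eF).
apply: (@has_matchingS (ksubsets r (K :\: e))).
  rewrite -setI_powerset subsetI KF; apply/subsetP => f.
  by rewrite !inE subsetD disjoints_subset => /andP[/andP[]].
apply: ksubsets_has_matching => //.
have : (#|K :&: e| < r)%N.
  rewrite -(unifF e eF); apply: proper_card.
  by rewrite properE subsetIr subsetI subxx andbT.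
by rewrite cardsD cardK mulnS; move: (r * t)%N; lia.
Qed.

Lemma edge_sub_clique r F K e t : (0 < r)%N -> uniform r F ->
  ~~ has_matching F t.+1 -> #|K| = (r * t.+1).-1 -> ksubsets r K \subset F ->
  e \in F -> e \subset K.
Proof.
move=> r_gt0 unifF no_match cardK KF eF; apply: contraNT no_match.
apply: (has_matching_clique_edge r_gt0 unifF cardK) => //.
by apply: subset_trans KF; apply: ksubsetsS; apply: subsetDl.
Qed.

Lemma card_cover_uniform r M : uniform r M -> (#|cover M| <= r * #|M|)%N.
Proof.
move=> unifM; rewrite (leq_trans (leq_card_cover M)) // mulnC -sum_nat_const.
by apply: leq_sum => e /unifM ->.
Qed.

Lemma has_matching_star r F T m t : (0 < r)%N -> uniform r F ->
  (r * t.+1 <= #|T|)%N -> m \in T ->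
  (forall e, e \in ksubsets r T -> m \in e -> e \in F) ->
  has_matching (F ::&: [set~ m]) t -> has_matching F t.+1.
Proof.
move=> r_gt0 unifF tT mT star /has_matchingP[M [MFm triv_M cardM]].
have MF f : f \in M -> (f \in F) && (m \notin f).
  by move=> /(subsetP MFm); rewrite in_ssetIC1.
have unifM : uniform r M by move=> f /MF/andP[/unifF].
have m_cover : m \notin cover M by apply/bigcupP => -[f /MF/andP[_ /negP]].
have [|B] := @ksubset_exists r.-1 (T :\: (m |: cover M)).
  rewrite cardsD; have := subset_leq_card (subsetIr T (m |: cover M)).
  by have := card_cover_uniform unifM; rewrite cardsU1 m_cover cardM; lia.
rewrite inE -setDDl subsetD subsetD1.
move=> /andP[/andP[/andP[BT m'B] disjB] /eqP cardB].
have mBF : m |: B \in F.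
  apply: star; last exact: setU11.
  by rewrite inE subUset sub1set mT BT cardsU1 m'B cardB add1n prednK /=.
apply: (has_matchingU1 r_gt0 unifF mBF).
apply/has_matchingP; exists M; split=> //.
apply/subsetP => f fM; have := subsetP MFm f fM.
rewrite !inE setCU subsetI => /andP[-> ->] /=.
rewrite -disjoints_subset disjoint_sym; apply: disjointWr disjB.
exact: (bigcup_sup f).
Qed.

(** * Shifting *)

Definition swap i j e := tperm i j @: e.

Lemma swapK i j : involutive (swap i j).
Proof.
move=> e; rewrite /swap -imset_comp -[RHS]imset_id; apply: eq_imset => v.
by rewrite /= tpermK.
Qed.

Lemma swap_inj i j : injective (swap i j).
Proof. exact: inv_inj (swapK i j). Qed.

Lemma card_swap i j e : #|swap i j e| = #|e|.
Proof. by rewrite card_imset //; apply: perm_inj. Qed.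

Lemma in_swap i j e v : (v \in swap i j e) = (tperm i j v \in e).
Proof. by rewrite -{1}[v](tpermK i j) mem_imset //; apply: perm_inj. Qed.

Lemma swap_id i j e : (i \in e) = (j \in e) -> swap i j e = e.
Proof.
move=> ij; apply/setP => v; rewrite in_swap.
by case: tpermP => // ->; rewrite ij.
Qed.

Lemma swap_sub i j e T :
  i \in T -> j \in T -> e \subset T -> swap i j e \subset T.
Proof.
move=> iT jT /subsetP eT; apply/subsetP => v; rewrite in_swap.
by case: tpermP => [->|->|_ _ /eT].
Qed.

Lemma disjoint_swap i j A B :
  [disjoint A & B] -> [disjoint swap i j A & swap i j B].
Proof.
rewrite -!setI_eq0 => /eqP AB0; rewrite /swap -imsetI ?AB0 ?imset0 //.
by move=> u v _ _; apply: perm_inj.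
Qed.

Definition shift_edge i j F e :=
  if [&& j \in e, i \notin e & swap i j e \notin F] then swap i j e else e.

Definition shift i j F := shift_edge i j F @: F.

Definition shifted m F :=
  [forall e in F, forall c in e, (m \notin e) ==> (swap m c e \in F)].

Lemma shift_edge_inj i j F : {in F &, injective (shift_edge i j F)}.
Proof.
move=> e f eF fF; rewrite /shift_edge.
case: ifP => [/and3P[_ _ eF'] | _]; case: ifP => [/and3P[_ _ fF'] | _] //.
- exact: swap_inj.
- by move=> ef; rewrite ef fF in eF'.
- by move=> fe; rewrite -fe eF in fF'.
Qed.

Lemma in_shift_new i j F e : e \in shift i j F -> e \notin F ->
  [/\ i \in e, j \notin e & swap i j e \in F].
Proof.
case/imsetP => f fF ->; rewrite /shift_edge.
case: ifP => [/and3P[jf i'f _] _|_].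
  by rewrite swapK !in_swap tpermL tpermR.
by rewrite fF.
Qed.

Lemma in_shift_old i j F e : e \in shift i j F -> i \notin e ->
  (e \in F) && (swap i j e \in F).
Proof.
case/imsetP => f fF ->; rewrite /shift_edge; case: ifP => [/and3P[jf _ _]|].
  by rewrite in_swap tpermL jf.
move=> fixf i'f; rewrite i'f andTb in fixf.
have [jf|j'f] := boolP (j \in f).
  by move: fixf; rewrite jf fF /= => /negbFE.
by rewrite fF swap_id ?fF // (negbTE i'f) (negbTE j'f).
Qed.

Lemma shift_uniform r i j F : uniform r F -> uniform r (shift i j F).
Proof.
move=> unifF _ /imsetP[e eF ->]; rewrite /shift_edge.
by case: ifP => _; rewrite ?card_swap unifF.
Qed.

Lemma shift_ksubsets r T i j F : i \in T -> j \in T ->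
  F \subset ksubsets r T -> shift i j F \subset ksubsets r T.
Proof.
move=> iT jT FT; apply: uniform_ksubsets => [|_ /imsetP[e eF ->]].
  exact: shift_uniform (ksubsets_uniform FT).
have eT := ksubsets_sub FT eF; rewrite /shift_edge.
by case: ifP => _ //; apply: swap_sub.
Qed.

Lemma shift_has_matching i j F t :
  has_matching (shift i j F) t -> has_matching F t.
Proof.
case/has_matchingP => M [MS triv_M cardM]; apply/has_matchingP.
have [MF|/subsetPn[e eM e'F]] := boolP (M \subset F); first by exists M.
have [ie _ seF] := in_shift_new (subsetP MS e eM) e'F.
exists [set swap i j f | f in M]; split; last first.
- by rewrite card_imset //; apply: swap_inj.
- apply/trivIsetP => _ _ /imsetP[f fM ->] /imsetP[g gM ->] fg.
  apply: disjoint_swap; apply: (trivIsetP triv_M) => //.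
  by apply: contraNneq fg => ->.
apply/subsetP => _ /imsetP[f fM ->]; have [-> //|fe] := eqVneq f e.
have i'f : i \notin f.
  by rewrite (disjointFl (trivIsetP triv_M f e fM eM fe) ie).
by have /andP[] := in_shift_old (subsetP MS f fM) i'f.
Qed.

Lemma shift_has_clique r i j F e0 t : (0 < r)%N -> uniform r F ->
  ~~ has_matching F t.+1 -> e0 \in F -> i \in e0 -> j \in e0 ->
  has_clique r (shift i j F) (r * t.+1).-1 -> has_clique r F (r * t.+1).-1.
Proof.
move=> r_gt0 unifF no_match e0F ie0 je0 /existsP[K /andP[cardK KS]].
apply/existsP; exists K; rewrite cardK /=.
have shift_notin e : e \in ksubsets r K -> i \notin e ->
    (e \in F) && (swap i j e \in F).
  by move=> /(subsetP KS); apply: in_shift_old.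
apply/subsetP => e eK; apply: contraNT no_match => e'F.
have [ie j'e _] := in_shift_new (subsetP KS e eK) e'F.
move: (eK); rewrite inE => /andP[eKs carde].
have iK : i \in K := subsetP eKs i ie.
have [jK|j'K] := boolP (j \in K).
  have seK : swap i j e \in ksubsets r K by rewrite inE swap_sub ?card_swap.
  have : i \notin swap i j e by rewrite in_swap tpermL.
  by move=> /(shift_notin _ seK)/andP[_]; rewrite swapK (negbTE e'F).
apply: (has_matching_clique_edge r_gt0 unifF (eqP cardK) _ e0F); last first.
  by apply: contra j'K => /subsetP; apply.
apply/subsetP => f; rewrite inE subsetD => /andP[/andP[fK disj] cardf].
have fK' : f \in ksubsets r K by rewrite inE fK.
by have /andP[] := shift_notin f fK' (negbT (disjointFl disj ie0)).
Qed.

Lemma shift_ssetIC1_proper m c F e : e \in F -> m \notin e -> c \in e ->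
  swap m c e \notin F -> shift m c F ::&: [set~ m] \proper F ::&: [set~ m].
Proof.
move=> eF m'e ce se'F; apply/properP; split.
  apply/subsetP => f; rewrite !in_ssetIC1 => /andP[fS m'f].
  by have /andP[-> _] := in_shift_old fS m'f.
exists e; rewrite in_ssetIC1 ?eF // m'e andbT.
by apply: contra se'F => /in_shift_old/(_ m'e)/andP[].
Qed.

Lemma shifted_setU1 r m F B e : uniform r.+1 F -> shifted m F ->
  e \in F -> B \subset e -> #|B| = r -> m \notin B -> m |: B \in F.
Proof.
move=> unifF shiftF eF Be cardB m'B.
have card_mB : #|m |: B| = r.+1 by rewrite cardsU1 m'B cardB.
have [me|m'e] := boolP (m \in e).
  suff -> : m |: B = e by [].
  by apply/eqP; rewrite eqEcard card_mB unifF // subUset sub1set me Be /=.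
have /card_gt0P[c] : (0 < #|e :\: B|)%N.
  by rewrite cardsD (setIidPr Be) cardB unifF // subSnn.
rewrite inE => /andP[c'B ce].
suff -> : m |: B = swap m c e.
  by have /forall_inP/(_ e eF)/forall_inP/(_ c ce)/implyP/(_ m'e) := shiftF.
apply/eqP; rewrite eqEcard card_mB card_swap unifF // leqnn andbT.
apply/subsetP => v; rewrite in_swap !inE => /predU1P[->|vB].
  by rewrite tpermL.
rewrite tpermD ?(subsetP Be) //; first by apply: contraNneq m'B => ->.
by apply: contraNneq c'B => ->.
Qed.

(* If [e = m |: [set a; b]], the pair [a, b] lies in some edge of [F], which is
   then shifted onto [e]. *)
Lemma shifted_star T F m e : F \subset ksubsets 3 T -> covers_pairs T F ->
  shifted m F -> e \in ksubsets 3 T -> m \in e -> e \in F.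
Proof.
move=> FT /forall_inP coverF shiftF; rewrite inE => /andP[eT carde] me.
have /cards2P[a [b [ab eE]]] : #|e :\ m| == 2%N.
  by move: carde; rewrite (cardsD1 m) me.
rewrite -(setD1K me); have [aT bT] : a \in T /\ b \in T.
  have /subsetP eT' : e :\ m \subset T by rewrite (subset_trans (subD1set e m)).
  by split; apply: eT'; rewrite eE !inE eqxx ?orbT.
have /forall_inP/(_ b bT)/implyP/(_ ab) := coverF a aT.
move=> /existsP[f /and3P[fF af bf]].
apply: (shifted_setU1 (ksubsets_uniform FT) shiftF fF).
- by rewrite eE subUset !sub1set af bf.
- by rewrite eE cards2 ab.
- by rewrite !inE eqxx.
Qed.

End SetFamilies.

(** * The Lagrange polynomial *)

Section LagrangePolynomial.
Variables (R : comNzRingType) (V : finType).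
Implicit Types (F : {set {set V}}) (e T : {set V}) (x y : V -> R).

Definition lagrange_sum F x : R := \sum_(e in F) \prod_(v in e) x v.

Definition elem_sym k T x := lagrange_sum (ksubsets k T) x.

Definition power_sum k T x : R := \sum_(v in T) x v ^+ k.

Lemma eq_lagrange_sum F x y : (forall e, e \in F -> {in e, x =1 y}) ->
  lagrange_sum F x = lagrange_sum F y.
Proof. by move=> xy; apply: eq_bigr => e /xy exy; apply: eq_bigr. Qed.

Lemma lagrange_sum_scale r F c x : uniform r F ->
  lagrange_sum F (fun v => c * x v) = c ^+ r * lagrange_sum F x.
Proof.
move=> unifF; rewrite /lagrange_sum mulr_sumr; apply: eq_bigr => e eF.
by rewrite big_split /= prodr_const unifF.
Qed.

Lemma lagrange_sum_link F v x :
  x v * lagrange_sum (link v F) x = \sum_(e in F | v \in e) \prod_(u in e) x u.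
Proof.
rewrite /lagrange_sum big_imset /=; last first.
  by move=> e f; rewrite !inE => /andP[_ ve] /andP[_ vf] ef;
    rewrite -(setD1K ve) ef setD1K.
rewrite mulr_sumr; apply: eq_big => [e|e]; rewrite inE // => /andP[_ ve].
by rewrite [RHS](big_setD1 v).
Qed.

Lemma lagrange_sum_rec F v x :
  lagrange_sum F x =
  x v * lagrange_sum (link v F) x + lagrange_sum (F ::&: [set~ v]) x.
Proof.
rewrite lagrange_sum_link /lagrange_sum (bigID (fun e : {set V} => v \in e)) /=.
by congr (_ + _); apply: eq_bigl => e; rewrite in_ssetIC1.
Qed.

Lemma lagrange_sum_euler r F x : uniform r F ->
  r%:R * lagrange_sum F x = \sum_v x v * lagrange_sum (link v F) x.
Proof.
move=> unifF.
under [RHS]eq_bigr => v _ do rewrite lagrange_sum_link big_mkcondr.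
rewrite exchange_big mulr_sumr; apply: eq_bigr => e eF /=.
by rewrite -big_mkcond sumr_const unifF // mulr_natl.
Qed.

Lemma elem_sym0 T x : elem_sym 0 T x = 1.
Proof.
rewrite /elem_sym /lagrange_sum (big_pred1 set0) ?big_set0 // => e.
by rewrite inE cards_eq0 andb_idl // => /eqP ->; rewrite sub0set.
Qed.

Lemma elem_sym_rec k T x v : v \in T ->
  elem_sym k.+1 T x = x v * elem_sym k (T :\ v) x + elem_sym k.+1 (T :\ v) x.
Proof.
move=> vT; rewrite /elem_sym (lagrange_sum_rec _ v) link_ksubsets //.
by rewrite ssetI_ksubsets setDE.
Qed.

Lemma elem_sym_euler k T x :
  k.+1%:R * elem_sym k.+1 T x = \sum_(v in T) x v * elem_sym k (T :\ v) x.
Proof.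
rewrite (lagrange_sum_euler _ (ksubsets_uniform (subxx _))) [RHS]big_mkcond /=.
apply: eq_bigr => v _; case: ifPn => vT; first by rewrite link_ksubsets.
rewrite lagrange_sum_link big1 // => e; rewrite inE => /andP[/andP[eT _] ve].
by rewrite (subsetP eT) in vT.
Qed.

Lemma sum_expr_elem_sym j k T x :
  \sum_(v in T) x v ^+ j * elem_sym k.+1 (T :\ v) x =
  power_sum j T x * elem_sym k.+1 T x
  - \sum_(v in T) x v ^+ j.+1 * elem_sym k (T :\ v) x.
Proof.
rewrite mulr_suml -sumrB; apply: eq_bigr => v vT.
by rewrite (elem_sym_rec k x vT) exprSr; ring.
Qed.

Lemma newton_elem_sym3 T x :
  6 * elem_sym 3 T x =
  power_sum 1 T x ^+ 3 - 3 * power_sum 1 T x * power_sum 2 T x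
  + 2 * power_sum 3 T x.
Proof.
have sum_elem_sym0 j :
    \sum_(v in T) x v ^+ j * elem_sym 0 (T :\ v) x = power_sum j T x.
  by apply: eq_bigr => v _; rewrite elem_sym0 mulr1.
have sum_elem_sym k : k.+1%:R * elem_sym k.+1 T x =
    \sum_(v in T) x v ^+ 1 * elem_sym k (T :\ v) x by exact: elem_sym_euler.
have := sum_elem_sym 2; have := sum_elem_sym 1; have := sum_elem_sym 0.
rewrite !sum_expr_elem_sym !sum_elem_sym0 mul1r => -> e2 e3.
have -> : 6 * elem_sym 3 T x = 2 * (3 * elem_sym 3 T x) by ring.
rewrite e3 mulrBr mulrCA e2; ring.
Qed.

End LagrangePolynomial.

Section LagrangianBounds.
Variables (R : realFieldType) (V : finType).
Implicit Types (F : {set {set V}}) (e T : {set V}) (x y : V -> R).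

Definition on_simplex T x := (forall v, 0 <= x v) /\ \sum_(v in T) x v = 1.

Definition lagrangian_bound F T b :=
  forall x, on_simplex T x -> lagrange_sum F x <= b.

Lemma on_simplex_le1 T x v : on_simplex T x -> v \in T -> x v <= 1.
Proof. by move=> [x0 <-] vT; rewrite (big_setD1 v) //= lerDl sumr_ge0. Qed.

Lemma lagrange_sum_ge0 F x : (forall v, 0 <= x v) -> 0 <= lagrange_sum F x.
Proof. by move=> x0; apply: sumr_ge0 => e _; apply: prodr_ge0. Qed.

Lemma lagrange_sumS F F' x : (forall v, 0 <= x v) -> F \subset F' ->
  lagrange_sum F x <= lagrange_sum F' x.
Proof.
move=> x0 FF'; rewrite {2}/lagrange_sum (big_setID F) /= (setIidPr FF') lerDl.
exact: lagrange_sum_ge0.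
Qed.

Lemma elem_sym_le_expr k T x : (forall v, 0 <= x v) ->
  k`!%:R * elem_sym k T x <= (\sum_(v in T) x v) ^+ k.
Proof.
move=> x0; elim: k => [|k IHk]; first by rewrite elem_sym0 expr0 mulr1.
rewrite factS natrM mulrAC elem_sym_euler mulrC mulr_sumr exprS mulr_suml.
apply: ler_sum => v _; rewrite mulrCA; apply: ler_wpM2l => //.
apply: le_trans IHk; apply: ler_wpM2l; first exact: ler0n.
by apply: lagrange_sumS => //; apply: ksubsetsS; apply: subD1set.
Qed.

Lemma lagrange_sum_le_expr k F T x :
  (forall v, 0 <= x v) -> F \subset ksubsets k T ->
  lagrange_sum F x <= (\sum_(v in T) x v) ^+ k / k`!%:R.
Proof.
move=> x0 FT; apply: le_trans (lagrange_sumS x0 FT) _.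
by rewrite ler_pdivlMr ?ltr0n ?fact_gt0 // mulrC; apply: elem_sym_le_expr.
Qed.

Lemma lagrange_sum_le_star k F T m x : (forall v, 0 <= x v) ->
  F \subset ksubsets k.+1 T ->
  lagrange_sum F x <= x m * ((\sum_(v in T :\ m) x v) ^+ k / k`!%:R)
                      + lagrange_sum (F ::&: [set~ m]) x.
Proof.
move=> x0 FT; rewrite (lagrange_sum_rec _ m) lerD2r; apply: ler_wpM2l => //.
exact/lagrange_sum_le_expr/link_ksubsets_sub.
Qed.

Lemma lagrangian_bound_homogeneous k F T b x : F \subset ksubsets k.+1 T ->
  lagrangian_bound F T b -> (forall v, 0 <= x v) ->
  lagrange_sum F x <= b * (\sum_(v in T) x v) ^+ k.+1.
Proof.
move=> FT Fb x0; set s := \sum_(v in T) x v; have [s0|s_neq0] := eqVneq s 0.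
  by have := lagrange_sum_le_expr x0 FT; rewrite -/s s0 expr0n mul0r mulr0.
have s_gt0 : 0 < s by rewrite lt_neqAle eq_sym s_neq0 sumr_ge0.
have -> : lagrange_sum F x = s ^+ k.+1 * lagrange_sum F (fun v => s^-1 * x v).
  rewrite (lagrange_sum_scale _ _ (ksubsets_uniform FT)) mulrA -exprMn divff //.
  by rewrite expr1n mul1r.
rewrite [leRHS]mulrC; apply: ler_wpM2l; first by rewrite exprn_ge0 // ltW.
apply: Fb; split=> [v|]; first by rewrite mulr_ge0 // invr_ge0 ltW.
by rewrite -mulr_sumr mulVf.
Qed.

Lemma lagrange_sum_shift F i j x : (forall v, 0 <= x v) -> x j <= x i ->
  lagrange_sum F x <= lagrange_sum (shift i j F) x.
Proof.
move=> x0 xji.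
rewrite {2}/lagrange_sum big_imset /=; last exact: shift_edge_inj.
apply: ler_sum => e _; rewrite /shift_edge; case: ifP => // /and3P[je i'e _].
rewrite (big_setD1 j) //= big_imset /=; last by move=> u v _ _; apply: perm_inj.
rewrite [leRHS](big_setD1 j) //= tpermR.
have -> : \prod_(v in e :\ j) x (tperm i j v) = \prod_(v in e :\ j) x v.
  apply: eq_bigr => v; rewrite !inE => /andP[vj ve].
  by rewrite tpermD // eq_sym //; apply: contraNneq i'e => <-.
by apply: ler_wpM2r => //; apply: prodr_ge0.
Qed.

(* The weight of [j] itself is left unchanged: [j] is discarded afterwards. *)
Definition merge i j x v : R := if v == i then x i + x j else x v.

Lemma merge_on_simplex T i j x : i \in T -> j \in T -> i != j ->
  on_simplex T x -> on_simplex (T :\ j) (merge i j x).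
Proof.
move=> iT jT ij [x0 sumx]; split=> [v|].
  by rewrite /merge; case: ifP => _; rewrite ?addr_ge0.
have iTj : i \in T :\ j by rewrite !inE ij.
rewrite -sumx (big_setD1 i iTj) [RHS](big_setD1 j) //=.
rewrite [in RHS](big_setD1 i iTj) /= /merge eqxx addrA [x i + _]addrC.
by congr (_ + _); apply: eq_bigr => v; rewrite !inE => /andP[/negPf ->].
Qed.

(* The polynomial is affine along the segment exchanging the weights of two
   vertices that lie in no common edge. *)
Lemma lagrange_sum_merge F i j x : 0 <= x j ->
  (forall e, e \in F -> ~~ ((i \in e) && (j \in e))) ->
  lagrange_sum (link j F) x <= lagrange_sum (link i F) x ->
  lagrange_sum F x <= lagrange_sum (F ::&: [set~ j]) (merge i j x).
Proof.
move=> xj ijF linkji; set F' := F ::&: [set~ j].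
have linkF' : link i F' = link i F.
  rewrite /link (_ : [set e in F' | i \in e] = [set e in F | i \in e]) //.
  apply/setP => e; rewrite [LHS]inE [RHS]inE in_ssetIC1.
  case: (boolP (e \in F)) => //= eF.
  by have := ijF e eF; case: (i \in e); rewrite ?andbT ?andbF.
have mergeE (G : {set {set V}}) : (forall e, e \in G -> i \notin e) ->
    lagrange_sum G (merge i j x) = lagrange_sum G x.
  move=> iG; apply: eq_lagrange_sum => e /iG i'e v ve; rewrite /merge.
  by case: eqP => // vi; rewrite -vi ve in i'e.
rewrite (lagrange_sum_rec _ j) -/F' !(lagrange_sum_rec F' i) linkF'.
rewrite !mergeE => [|e|e]; first last.
- by case/imsetP => f _ ->; rewrite !inE eqxx.
- by rewrite in_ssetIC1 => /andP[].
by rewrite /merge eqxx mulrDl addrCA addrA lerD2r lerD2l ler_wpM2l.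
Qed.

(** * Triples on few vertices *)

Definition clique_lagrangian (p : R) : R := (p - 1) * (p - 2) / (6 * p ^+ 2).

(* A lower bound on the loss [(1 - 4 / p) / 6 * (4 * p ^+ 2)^-1] of
   [elem_sym3_gap] for [p >= 5]. *)
Definition stability_gap (p : R) : R := (24 * p ^+ 3)^-1.

Definition excess (p : nat) T x : R := power_sum 2 T x - p%:R^-1.

Lemma excessE p T x : (0 < p)%N -> on_simplex T x ->
  excess p T x =
  \sum_(v in T) (x v - p%:R^-1) ^+ 2 + (p%:R - #|T|%:R) / p%:R ^+ 2.
Proof.
move=> p_gt0 [_ sumx]; have pn0 : p%:R != 0 :> R by rewrite pnatr_eq0 -lt0n.
have -> : \sum_(v in T) (x v - p%:R^-1) ^+ 2 =
    power_sum 2 T x - 2 / p%:R * \sum_(v in T) x v + p%:R^-1 ^+ 2 * #|T|%:R.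
  rewrite /power_sum -sumr_const !mulr_sumr -sumrB -big_split /=.
  by apply: eq_bigr => v _; ring.
by rewrite sumx /excess; field.
Qed.

Lemma excess_ge0 p T x : (0 < p)%N -> (#|T| <= p)%N -> on_simplex T x ->
  0 <= excess p T x.
Proof.
move=> p_gt0 Tp simplex_x; rewrite excessE // addr_ge0 //.
  by apply: sumr_ge0 => v _; apply: sqr_ge0.
by rewrite divr_ge0 ?exprn_ge0 ?subr_ge0 ?ler_nat.
Qed.

Lemma excess_ge_dev p T x a : (0 < p)%N -> (#|T| <= p)%N -> on_simplex T x ->
  a \in T -> (x a - p%:R^-1) ^+ 2 <= excess p T x.
Proof.
move=> p_gt0 Tp simplex_x aT; rewrite excessE // (big_setD1 a) //= -addrA lerDl.
rewrite addr_ge0 ?divr_ge0 ?exprn_ge0 ?subr_ge0 ?ler_nat //.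
by apply: sumr_ge0 => v _; apply: sqr_ge0.
Qed.

Lemma excess_ge_light p T x a : (0 < p)%N -> (#|T| <= p)%N -> on_simplex T x ->
  a \in T -> x a <= (2 * p%:R)^-1 -> (4 * p%:R ^+ 2)^-1 <= excess p T x.
Proof.
move=> p_gt0 Tp simplex_x aT xa.
apply: le_trans (excess_ge_dev p_gt0 Tp simplex_x aT).
have p_gt0R : 0 < p%:R :> R by rewrite ltr0n.
have half : p%:R^-1 = 2 * (2 * p%:R)^-1 :> R by field; rewrite gt_eqF.
have -> : (4 * p%:R ^+ 2)^-1 = (2 * p%:R)^-1 ^+ 2 :> R.
  by field; rewrite gt_eqF.
have inv_ge0 : 0 <= (2 * p%:R)^-1 :> R by rewrite invr_ge0 mulr_ge0 // ltW.
rewrite -[leRHS]sqrrN opprB ler_sqr ?nnegrE; lra.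
Qed.

Lemma excess_ge_missing p T x : (#|T| < p)%N -> on_simplex T x ->
  p%:R ^- 2 <= excess p T x.
Proof.
move=> Tp simplex_x; have p_gt0 : (0 < p)%N by apply: leq_ltn_trans Tp.
rewrite excessE //; apply: ler_wpDl.
  by apply: sumr_ge0 => v _; apply: sqr_ge0.
rewrite -[leLHS]mul1r ler_wpM2r ?invr_ge0 ?exprn_ge0 //.
by rewrite lerBrDr nat1r ler_nat.
Qed.

(* Expand the nonnegative sum of [(x v - p^-1) ^+ 2 * (1 - x v)] over [T]. *)
Lemma elem_sym3_le_excess p T x :
  (0 < p)%N -> (#|T| <= p)%N -> on_simplex T x ->
  elem_sym 3 T x <= clique_lagrangian p%:R - (1 - 4 / p%:R) / 6 * excess p T x.
Proof.
move=> p_gt0 Tp simplex_x; have [x0 sumx] := simplex_x.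
have pn0 : p%:R != 0 :> R by rewrite pnatr_eq0 -lt0n.
have sum1 : power_sum 1 T x = 1 by rewrite -sumx.
have dev_ge0 : 0 <= \sum_(v in T) (x v - p%:R^-1) ^+ 2 * (1 - x v).
  apply: sumr_ge0 => v vT.
  by rewrite mulr_ge0 ?sqr_ge0 ?subr_ge0 // (on_simplex_le1 simplex_x).
have devE : \sum_(v in T) (x v - p%:R^-1) ^+ 2 * (1 - x v) =
    (1 + 2 / p%:R) * power_sum 2 T x - power_sum 3 T x
    - (2 / p%:R + p%:R^-1 ^+ 2) * power_sum 1 T x + p%:R^-1 ^+ 2 * #|T|%:R.
  rewrite /power_sum -sumr_const !mulr_sumr -!sumrB -big_split /=.
  by apply: eq_bigr => v _; ring.
have card_le : p%:R^-1 ^+ 2 * #|T|%:R <= p%:R^-1 :> R.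
  rewrite -[leRHS]mulr1 expr2 -mulrA ler_wpM2l ?invr_ge0 //.
  by rewrite mulrC ler_pdivrMr ?ltr0n // mul1r ler_nat.
have := newton_elem_sym3 T x; move: dev_ge0; rewrite devE sum1 /excess.
have -> : clique_lagrangian p%:R = 6^-1 - p%:R^-1 / 2 + p%:R^-1 ^+ 2 / 3.
  by rewrite /clique_lagrangian; field.
by move: card_le; set q := p%:R^-1; lra.
Qed.

Lemma clique_lagrangian_ffact p : (0 < p)%N ->
  clique_lagrangian p%:R = (p ^_ 3)%:R / p%:R ^+ 3 / 6 :> R.
Proof.
case: p => [|[|p]] // _; first by rewrite /clique_lagrangian subrr !mul0r.
rewrite !ffactnS ffactn0 muln1 !natrM /= -[p.+2]addn2 -[p.+1]addn1 !natrD.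
have p_ge0 : 0 <= p%:R :> R by [].
by rewrite /clique_lagrangian; field; apply/eqP; lra.
Qed.

Lemma clique_lagrangian_ge0 p : 2 <= p -> 0 <= clique_lagrangian p.
Proof. by move=> p2; rewrite divr_ge0 ?mulr_ge0 ?exprn_ge0 //; lra. Qed.

Lemma stability_gap_gt0 p : 0 < p -> 0 < stability_gap p.
Proof. by move=> p0; rewrite invr_gt0 mulr_gt0 ?exprn_gt0. Qed.

Lemma stability_gap_le_clique_lagrangian p :
  3 <= p -> stability_gap p <= clique_lagrangian p.
Proof.
move=> p3; rewrite -subr_ge0.
have -> : clique_lagrangian p - stability_gap p =
    (4 * p * ((p - 1) * (p - 2)) - 1) / (24 * p ^+ 3).
  by rewrite /clique_lagrangian /stability_gap; field; apply/eqP; lra.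
have p_ge6 : 3 * (2 * 1) <= p * ((p - 1) * (p - 2)) by rewrite !ler_pM //; lra.
by rewrite divr_ge0 ?mulr_ge0 ?exprn_ge0 //; lra.
Qed.

Lemma elem_sym3_le_clique p T x :
  (4 <= p)%N -> (#|T| <= p)%N -> on_simplex T x ->
  elem_sym 3 T x <= clique_lagrangian p%:R.
Proof.
move=> p4 Tp simplex_x; have p_gt0 : (0 < p)%N by lia.
apply: le_trans (elem_sym3_le_excess p_gt0 Tp simplex_x) _; rewrite gerBl.
have p4R : 4 <= p%:R :> R by rewrite (ler_nat R 4).
rewrite mulr_ge0 ?excess_ge0 // divr_ge0 // subr_ge0 ler_pdivrMr; lra.
Qed.

Lemma lagrangian_bound_ksubsets3 p F T : (4 <= p)%N -> (#|T| <= p)%N ->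
  F \subset ksubsets 3 T -> lagrangian_bound F T (clique_lagrangian p%:R).
Proof.
move=> p4 Tp FT x simplex_x.
apply: le_trans (elem_sym3_le_clique p4 Tp simplex_x).
by apply: lagrange_sumS FT; case: simplex_x.
Qed.

Lemma elem_sym3_gap p T x : (5 <= p)%N -> (#|T| <= p)%N -> on_simplex T x ->
  (4 * p%:R ^+ 2)^-1 <= excess p T x ->
  elem_sym 3 T x <= clique_lagrangian p%:R - stability_gap p%:R.
Proof.
move=> p5 Tp simplex_x gap_x.
have p5R : 5 <= p%:R :> R by rewrite (ler_nat R 5).
have p_gt0 : (0 < p)%N by apply: leq_trans p5.
apply: le_trans (elem_sym3_le_excess p_gt0 Tp simplex_x) _.
rewrite lerD2l lerN2.
have coef_ge0 : 0 <= (1 - 4 / p%:R) / 6 :> R.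
  by rewrite divr_ge0 // subr_ge0 ler_pdivrMr; lra.
apply: le_trans (ler_wpM2l coef_ge0 gap_x); rewrite -subr_ge0.
have -> : (1 - 4 / p%:R) / 6 * (4 * p%:R ^+ 2)^-1 - stability_gap p%:R =
    (p%:R - 5) / (24 * p%:R ^+ 3) :> R.
  by rewrite /stability_gap; field; apply/eqP; lra.
by rewrite divr_ge0 ?mulr_ge0 ?exprn_ge0 ?subr_ge0 //; lra.
Qed.

Lemma stability_gap_le_cube p : 0 < p -> stability_gap p <= (2 * p)^-1 ^+ 3.
Proof.
move=> p_gt0; have p3_gt0 : 0 < p ^+ 3 by rewrite exprn_gt0.
by rewrite exprVn exprMn lef_pV2 ?posrE ?mulr_gt0 ?ler_pM2r //; lra.
Qed.

(* If a vertex of the missing edge has weight less than [1/(2p)], the weights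
   are far from uniform; otherwise the product over the missing edge is at least
   [1/(2p)^3]. *)
Lemma lagrangian_bound_no_clique p F T : (5 <= p)%N -> (#|T| <= p)%N ->
  F \subset ksubsets 3 T -> ~~ has_clique 3 F p ->
  lagrangian_bound F T (clique_lagrangian p%:R - stability_gap p%:R).
Proof.
move=> p5 Tp FT no_clique x simplex_x; have [x0 _] := simplex_x.
have p5R : 5 <= p%:R :> R by rewrite (ler_nat R 5).
have gap_of_excess : (4 * p%:R ^+ 2)^-1 <= excess p T x ->
    lagrange_sum F x <= clique_lagrangian p%:R - stability_gap p%:R.
  move=> gap_x; apply: le_trans (elem_sym3_gap p5 Tp simplex_x gap_x).
  exact: lagrange_sumS.
have [Tlt|Tge] := ltnP #|T| p.
  apply: gap_of_excess; apply: le_trans (excess_ge_missing Tlt simplex_x).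
  by rewrite invfM ler_piMl ?invr_ge0 ?exprn_ge0 // invf_le1; lra.
have /subsetPn[e eT e'F] : ~~ (ksubsets 3 T \subset F).
  apply: contra no_clique => TF; apply/existsP; exists T.
  by rewrite TF eqn_leq Tp Tge.
have [/existsP[a /andP[ae xa]]|heavy_e] :=
    boolP [exists a, (a \in e) && (x a < (2 * p%:R)^-1)].
  have aT : a \in T by apply: subsetP ae; case/setIdP: eT.
  apply: gap_of_excess; apply: (excess_ge_light _ Tp simplex_x aT (ltW xa)).
  exact: leq_trans p5.
have heavy : (2 * p%:R)^-1 ^+ 3 <= \prod_(v in e) x v.
  have /andP[_ /eqP <-] : (e \subset T) && (#|e| == 3%N) by rewrite inE in eT.
  rewrite -prodr_const; apply: ler_prod => v ve.
  rewrite invr_ge0 mulr_ge0 //= leNgt; apply: contra heavy_e => xv.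
  by apply/existsP; exists v; rewrite ve.
have eFT : e |: F \subset ksubsets 3 T by rewrite subUset sub1set eT.
have := lagrangian_bound_ksubsets3 (ltnW p5) Tp eFT simplex_x.
have p_gt0R : 0 < p%:R :> R by lra.
have := stability_gap_le_cube p_gt0R.
rewrite {1}/lagrange_sum big_setU1 //= -/(lagrange_sum F x); lra.
Qed.

(** * Induction on the size of the matching *)

Lemma exists_shifted r t F T m x : (0 < r)%N -> F \subset ksubsets r T ->
  ~~ has_matching F t.+1 -> ~~ has_clique r F (r * t.+1).-1 ->
  m \in T -> (forall v, 0 <= x v) -> {in T, forall v, x v <= x m} ->
  exists G : {set {set V}}, [/\ G \subset ksubsets r T,
    ~~ has_matching G t.+1 /\ ~~ has_clique r G (r * t.+1).-1,
    lagrange_sum F x <= lagrange_sum G x & covers_pairs T G -> shifted m G].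
Proof.
move=> r_gt0 FT no_match no_clique mT x0 xm.
pose admissible (G : {set {set V}}) :=
  [&& G \subset ksubsets r T, ~~ has_matching G t.+1,
  ~~ has_clique r G (r * t.+1).-1 & lagrange_sum F x <= lagrange_sum G x].
have admF : admissible F by apply/and4P; split.
case: (arg_minnP (fun G : {set {set V}} => #|G ::&: [set~ m]|) admF) => G.
move=> /and4P[GT no_matchG no_cliqueG FG] minG; exists G; split=> // coverG.
apply/forall_inP => e eG; apply/forall_inP => c ce; apply/implyP => m'e.
apply: contraT => se'G; have cT := subsetP (ksubsets_sub GT eG) c ce.
have mc : m != c by apply: contraNneq m'e => ->.
have /forall_inP/(_ m mT)/forall_inP/(_ c cT)/implyP/(_ mc) := coverG.
move=> /existsP[e0 /and3P[e0G me0 ce0]].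
have : admissible (shift m c G).
  apply/and4P; split; first exact: shift_ksubsets.
  - by apply: contra no_matchG; apply: shift_has_matching.
  - apply: contra no_cliqueG.
    exact: (shift_has_clique r_gt0 (ksubsets_uniform GT) no_matchG e0G me0 ce0).
  - by apply: le_trans FG _; apply: lagrange_sum_shift => //; apply: xm.
by move/minG; rewrite leqNgt proper_card // (shift_ssetIC1_proper eG m'e ce).
Qed.

Lemma uncovered_merge r F T x : F \subset ksubsets r T -> on_simplex T x ->
  ~~ covers_pairs T F -> exists j y, [/\ j \in T, on_simplex (T :\ j) y &
    lagrange_sum F x <= lagrange_sum (F ::&: [set~ j]) y].
Proof.
move=> FT simplex_x; have [x0 _] := simplex_x.
rewrite negb_forall_in => /exists_inP[i iT].
rewrite negb_forall_in => /exists_inP[j jT]; rewrite negb_imply => /andP[ij].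
rewrite negb_exists_in => /forall_inP ijF.
have [ji_link|/ltW ij_link] :=
    lerP (lagrange_sum (link j F) x) (lagrange_sum (link i F) x).
  exists j, (merge i j x); split=> //; first exact: merge_on_simplex.
  exact: lagrange_sum_merge.
exists i, (merge j i x); split=> //.
  by apply: merge_on_simplex; rewrite 1?eq_sym.
by apply: lagrange_sum_merge => // e /ijF; rewrite andbC.
Qed.

(* The maximum is attained at [u = k^-1]. *)
Lemma cubic_le_invsqr (k u : R) :
  0 < k -> 0 <= u -> 3 * u ^+ 2 - 2 * k * u ^+ 3 <= k ^- 2.
Proof.
move=> k0 u0; rewrite -(ler_pM2l (exprn_gt0 2 k0)) divff ?expf_neq0 ?gt_eqF //.
have : 0 <= (1 - k * u) ^+ 2 * (1 + 2 * (k * u)).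
  by rewrite mulr_ge0 ?sqr_ge0 ?addr_ge0 ?mulr_ge0 // ltW.
lra.
Qed.

Lemma star_gap (a q : R) : a <= 1 -> 2 <= q ->
  a * ((1 - a) ^+ 2 / 2) + clique_lagrangian q * (1 - a) ^+ 3 <=
  clique_lagrangian (q + 3) - stability_gap (q + 3).
Proof.
move=> a1 q2; set u := 1 - a; have u0 : 0 <= u by rewrite subr_ge0.
have q_neq0 : q != 0 by apply/eqP; lra.
(* [k] is such that [6 * clique_lagrangian q = 3 - 2 * k]. *)
set k := (2 * q - 1) * (q + 2) / (2 * q ^+ 2).
have k0 : 0 < k by rewrite divr_gt0 ?mulr_gt0 ?exprn_gt0 //; lra.
have -> : a * (u ^+ 2 / 2) + clique_lagrangian q * u ^+ 3 =
    (3 * u ^+ 2 - 2 * k * u ^+ 3) / 6.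
  by rewrite /u /clique_lagrangian /k; field.
apply: (@le_trans _ _ (k ^- 2 / 6)); first by rewrite ler_pM2r ?cubic_le_invsqr.
(* The difference of the two sides has positive coefficients in [q - 2]. *)
have [s s0 qE] : exists2 s, 0 <= s & q = s + 2 by exists (q - 2); lra.
rewrite -subr_ge0 /k qE.
have -> : clique_lagrangian (s + 2 + 3) - stability_gap (s + 2 + 3)
    - ((2 * (s + 2) - 1) * (s + 2 + 2) / (2 * (s + 2) ^+ 2)) ^- 2 / 6 =
  (36 * s ^+ 5 + 524 * s ^+ 4 + 2800 * s ^+ 3 + 6695 * s ^+ 2 + 6968 * s + 2416)
  / (24 * (s + 5) ^+ 3 * ((2 * s + 3) * (s + 4)) ^+ 2).
  rewrite /clique_lagrangian /stability_gap; field.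
  by rewrite ?mulf_neq0 ?andbT //; do ?(apply/andP; split); apply/eqP; lra.
apply: divr_ge0; last by rewrite !mulr_ge0 ?exprn_ge0 ?mulr_ge0 //; lra.
have [] : [/\ 0 <= s ^+ 2, 0 <= s ^+ 3, 0 <= s ^+ 4 & 0 <= s ^+ 5].
  by split; apply: exprn_ge0.
lra.
Qed.

Definition matching_free_bounded t := forall F T, F \subset ksubsets 3 T ->
  ~~ has_matching F t.+1 ->
  lagrangian_bound F T (clique_lagrangian (3 * t.+1).-1%:R).

Lemma lagrange_sum_star_gap t F T m x : matching_free_bounded t ->
  F \subset ksubsets 3 T -> ~~ has_matching F t.+2 -> (3 * t.+2 <= #|T|)%N ->
  m \in T -> (forall e, e \in ksubsets 3 T -> m \in e -> e \in F) ->
  on_simplex T x ->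
  lagrange_sum F x <=
  clique_lagrangian (3 * t.+2).-1%:R - stability_gap (3 * t.+2).-1%:R.
Proof.
move=> bounded_t FT no_match tT mT star simplex_x; have [x0 sumx] := simplex_x.
have sum_rest : \sum_(v in T :\ m) x v = 1 - x m.
  by rewrite -sumx [in RHS](big_setD1 m) //= addrAC subrr add0r.
have no_match' : ~~ has_matching (F ::&: [set~ m]) t.+1.
  apply: contra no_match.
  exact: (has_matching_star (isT : 0 < 3)%N (ksubsets_uniform FT) tT mT star).
have FmT := ssetIC1_ksubsets m FT.
have := lagrangian_bound_homogeneous FmT (bounded_t _ _ FmT no_match') x0.
have := lagrange_sum_le_star m x0 FT; rewrite sum_rest (_ : 2`!%:R = 2) //.
have q_ge2 : 2 <= (3 * t.+1).-1%:R :> R by rewrite (ler_nat R 2) mulnS.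
have := star_gap (on_simplex_le1 simplex_x mT) q_ge2.
have -> : (3 * t.+2).-1%:R = (3 * t.+1).-1%:R + 3 :> R.
  by rewrite -(natrD R _ 3); congr (_%:R); lia.
lra.
Qed.

Lemma lagrangian_bound_gap t F T : matching_free_bounded t ->
  F \subset ksubsets 3 T -> ~~ has_matching F t.+2 ->
  ~~ has_clique 3 F (3 * t.+2).-1 ->
  lagrangian_bound F T
    (clique_lagrangian (3 * t.+2).-1%:R - stability_gap (3 * t.+2).-1%:R).
Proof.
move=> bounded_t; have [n] := ubnP #|T|; elim: n F T => // n IHn F T.
rewrite ltnS => Tn FT no_match no_clique x simplex_x; have [x0 _] := simplex_x.
have [Tp|Tp] := leqP #|T| (3 * t.+2).-1.
  by apply: (lagrangian_bound_no_clique _ Tp FT); first by lia.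
have [m mT xm] : exists2 m, m \in T & {in T, forall v, x v <= x m}.
  have /card_gt0P[v vT] : (0 < #|T|)%N by apply: leq_ltn_trans Tp.
  by case: (arg_maxP x vT) => m; exists m.
have [G [GT [no_matchG no_cliqueG] FG shiftG]] :=
  exists_shifted (isT : 0 < 3)%N FT no_match no_clique mT x0 xm.
apply: le_trans FG _; have [coverG|uncovered] := boolP (covers_pairs T G).
  apply: (lagrange_sum_star_gap bounded_t GT no_matchG Tp mT _ simplex_x) => e.
  exact: (shifted_star GT coverG (shiftG coverG)).
have [j [y [jT simplex_y Gy]]] := uncovered_merge GT simplex_x uncovered.
apply: le_trans Gy _.
have GjG : G ::&: [set~ j] \subset G by rewrite -setI_powerset subsetIl.
apply: IHn simplex_y; last 1 first.
- by apply: contra no_cliqueG; apply: has_cliqueS.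
- by move: Tn; rewrite (cardsD1 j) jT.
- exact: ssetIC1_ksubsets.
- by apply: contra no_matchG; apply: has_matchingS.
Qed.

Lemma matching_free_bound t : matching_free_bounded t.
Proof.
elim: t => [|t IHt] F T FT no_match x simplex_x; have [x0 sumx] := simplex_x.
  have [->|[e eF]] := set_0Vmem F; last first.
    case/negP: no_match.
    exact: (has_matchingU1 _ (ksubsets_uniform FT) eF (has_matching0 _)).
  by rewrite /lagrange_sum big_set0 clique_lagrangian_ge0.
have [|no_clique] := boolP (has_clique 3 F (3 * t.+2).-1); last first.
  apply: le_trans (lagrangian_bound_gap IHt FT no_match no_clique simplex_x) _.
  by rewrite gerBl ltW // stability_gap_gt0 // ltr0n; lia.
case/existsP => K /andP[/eqP cardK KF].
have FKT : F \subset ksubsets 3 (K :&: T).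
  apply: (uniform_ksubsets (ksubsets_uniform FT)) => e eF; rewrite subsetI.
  rewrite (ksubsets_sub FT eF) andbT.
  exact: (edge_sub_clique _ (ksubsets_uniform FT) no_match cardK KF eF).
have KTp : (#|K :&: T| <= (3 * t.+2).-1)%N.
  by rewrite -cardK subset_leq_card ?subsetIl.
have p4 : (4 <= (3 * t.+2).-1)%N by lia.
have KT_bound := lagrangian_bound_ksubsets3 p4 KTp FKT.
apply: le_trans (lagrangian_bound_homogeneous FKT KT_bound x0) _.
apply: ler_piMr.
  by rewrite clique_lagrangian_ge0 // (ler_nat R 2) (leq_trans _ p4).
rewrite exprn_ile1 ?sumr_ge0 // -sumx [leRHS](big_setID K) /= setIC lerDl.
exact: sumr_ge0.
Qed.

End LagrangianBounds.

(** * Lagrangians of hypergraphs *)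

Lemma has_matching_contains_copy r (G : r_graph r) t :
  has_matching (edges G) t -> contains_copy G (matching_rgraph r t).
Proof.
case/has_matchingP => M [/subsetP MG triv_M cardM].
pose E (i : 'I_t) := enum_val (cast_ord (esym cardM) i).
have EM i : E i \in M by apply: enum_valP.
have cardE i : r = #|E i| by rewrite edges_card ?MG.
pose f (ij : 'I_t * 'I_r) := enum_val (cast_ord (cardE ij.1) ij.2).
have fE i j : f (i, j) \in E i by apply: enum_valP.
have f_inj : injective f.
  move=> [i j] [i' j'] eq_f; have ii' : i = i'.
    apply: (can_inj (cast_ordK (esym cardM))); apply: enum_val_inj.
    apply: contraTeq (fE i j) => EE'.
    by rewrite eq_f (disjointFl (trivIsetP triv_M _ _ (EM i) (EM i') EE')).
  by move: eq_f; rewrite -ii' => /enum_val_inj/cast_ord_inj /= ->.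
exists f; split=> // e /imsetP[i _ ->].
suff -> : f @: [set (i, j) | j in 'I_r] = E i by apply: MG.
apply/eqP; rewrite eqEcard -cardE !card_imset ?card_ord //; last by move=> j k [].
rewrite leqnn andbT; apply/subsetP => _ /imsetP[_ /imsetP[j _ ->] ->].
exact: fE.
Qed.

Lemma has_clique_iso r (G : r_graph r) t : (0 < r)%N ->
  ~~ has_matching (edges G) t.+1 ->
  (forall v : vertex G, ~ isolated_vertex v) ->
  has_clique r (edges G) (r * t.+1).-1 ->
  rgraph_iso G (complete_rgraph r (r * t.+1).-1).
Proof.
move=> r_gt0 no_match no_isolated /existsP[K /andP[/eqP cardK KG]].
have unifG : uniform r (edges G) by move=> e; apply: edges_card.
have KT : K = [set: vertex G].
  apply/setP => v; rewrite inE; apply: contra_notT (no_isolated v) => v'K e eG.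
  apply: contra v'K; apply: subsetP v.
  exact: (edge_sub_clique r_gt0 unifG no_match cardK KG eG).
have cardV : #|vertex G| = (r * t.+1).-1 by rewrite -cardsT -KT.
have rank_bij : bijective (fun v : vertex G => cast_ord cardV (enum_rank v)).
  exists (fun i => enum_val (cast_ord (esym cardV) i)) => v.
    by rewrite cast_ordK enum_rankK.
  by rewrite enum_valK cast_ordKV.
exists (fun v => cast_ord cardV (enum_rank v)); split=> // e.
rewrite inE card_imset; last exact: bij_inj.
apply/idP/eqP => [/unifG//|carde]; apply: (subsetP KG).
by rewrite inE KT subsetT carde /=.
Qed.

Section Lagrangian.
Variable R : realType.

Lemma simplex_on_simplex (V : finType) (x : V -> R) :
  simplex x -> on_simplex [set: V] x.
Proof.
move=> [x0 sumx]; split=> //; rewrite -sumx.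
by apply: eq_bigl => v; rewrite inE.
Qed.

Lemma lagrangian_le r (G : r_graph r) (b : R) : 0 <= b ->
  lagrangian_bound (edges G) [set: vertex G] b -> lagrangian R G <= b.
Proof.
move=> b_ge0 Gb; rewrite /lagrangian; set S := (X in sup X).
have S_le y : S y -> y <= b.
  by move=> [x /simplex_on_simplex simplex_x <-]; apply: Gb.
have [S0|/nonemptyPn S0] := pselect (nonempty S); first exact: ge_sup.
by rewrite S0 sup0.
Qed.

Lemma lagrange_poly_uniform r p :
  lagrange_poly (complete_rgraph r p) (fun=> p%:R^-1) =
  'C(p, r)%:R / p%:R ^+ r :> R.
Proof.
rewrite /lagrange_poly (eq_bigr (fun=> p%:R ^- r)) => [|e]; last first.
  by rewrite inE => /eqP <-; rewrite prodr_const exprVn.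
by rewrite sumr_const -[LHS]mulr_natl /= /complete_edges card_draws card_ord.
Qed.

Lemma lagrangian_complete p : (4 <= p)%N ->
  lagrangian R (complete_rgraph 3 p) = clique_lagrangian p%:R.
Proof.
move=> p4; have p_gt0 : (0 < p)%N by apply: leq_trans p4.
have p_ge2 : 2 <= p%:R :> R by rewrite (ler_nat R 2) (leq_trans _ p4).
have complete_bound : lagrangian_bound (edges (complete_rgraph 3 p)) [set: 'I_p]
    (clique_lagrangian p%:R : R).
  apply: lagrangian_bound_ksubsets3; rewrite ?cardsT ?card_ord //.
  by apply: uniform_ksubsets => // e; apply: edges_card.
apply/eqP; rewrite eq_le lagrangian_le ?clique_lagrangian_ge0 //=.
have -> : clique_lagrangian p%:R =
    lagrange_poly (complete_rgraph 3 p) (fun=> p%:R^-1) :> R.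
  rewrite lagrange_poly_uniform clique_lagrangian_ffact // -bin_ffact natrM.
  by rewrite [3`!%:R](_ : _ = 6) // mulrAC mulfK.
apply: ub_le_sup; last first.
  exists (fun=> p%:R^-1) => //; split=> [_|]; first by rewrite invr_ge0.
  by rewrite sumr_const card_ord -[LHS]mulr_natr mulVf ?pnatr_eq0 -?lt0n.
exists (clique_lagrangian p%:R) => _ [x /simplex_on_simplex simplex_x <-].
exact: complete_bound.
Qed.

End Lagrangian.

Theorem theorem3p3 (R : realType) (t : nat) (ht : (2 <= t)%N) :
  exists c1 : R, 0 < c1 /\
    forall G : r_graph 3,
      ~ contains_copy G (matching_rgraph 3 t) ->
      (forall v : vertex G, ~ isolated_vertex v) ->
      ~ rgraph_iso G (complete_rgraph 3 (3 * t - 1)) ->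
      lagrangian R G <= lagrangian R (complete_rgraph 3 (3 * t - 1)) - c1 /\
      lagrangian R (complete_rgraph 3 (3 * t - 1)) - c1 =
        1 / 6%:R * (((3 * t - 1) ^_ 3)%:R / (3 * t - 1)%:R ^+ 3 - 6%:R * c1).
Proof.
have [t' tE] : exists t', t = t'.+2 by exists t.-2; lia.
have p5 : (5 <= (3 * t'.+2).-1)%N by lia.
rewrite {t ht}tE subn1; exists (stability_gap (3 * t'.+2).-1%:R).
split=> [|G no_copy no_isolated no_iso].
  by rewrite stability_gap_gt0 // ltr0n (leq_trans _ p5).
rewrite lagrangian_complete ?(ltnW p5) //; split; last first.
  by rewrite clique_lagrangian_ffact ?(leq_trans _ p5) //; lra.
have unifG : uniform 3 (edges G) by move=> e; apply: edges_card.
have no_match : ~~ has_matching (edges G) t'.+2.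
  by apply/negP => /has_matching_contains_copy.
have no_clique : ~~ has_clique 3 (edges G) (3 * t'.+2).-1.
  by apply/negP => /(has_clique_iso (isT : 0 < 3)%N no_match no_isolated).
apply: lagrangian_le.
  rewrite subr_ge0 stability_gap_le_clique_lagrangian //.
  by rewrite (ler_nat R 3) (leq_trans _ p5).
apply: lagrangian_bound_gap no_match no_clique.
  exact: matching_free_bound.
by apply: uniform_ksubsets unifG _ => e _; apply: subsetT.
Qed.
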